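(* Fix an o-minimal structure. Let $D \colon \mathbb{R}^p \rightrightarrows \mathbb{R}^p$ be a conservative field for $f\colon\mathbb{R}^p\to\mathbb{R}$, and assume $f$ and $D$ are definable. Then the set of $D$-critical values $\{f(x) : x \in \mathbb{R}^p,\ 0 \in D(x)\}$ is finite.
   Context: A set valued map $D\colon\mathbb{R}^p\rightrightarrows\mathbb{R}^p$ is a conservative field if its graph is closed, its values are nonempty and compact, and for every absolutely continuous loop $\gamma\colon[0,1]\to\mathbb{R}^p$, $\int_0^1 \max_{v\in D(\gamma(t))}\langle\dot\gamma(t),v\rangle\,dt=0$; $D$ is a conservative field for $f$ if moreover $f(x)=f(0)+\int_0^1\max_{v\in D(\gamma(t))}\langle\dot\gamma(t),v\rangle\,dt$ for every absolutely continuous $\gamma$ from $0$ to $x$. Definable means belonging (via graph, for maps) to a fixed o-minimal structure on $(\mathbb{R},+,\cdot)$, e.g. the semialgebraic sets: a family of Boolean algebras of subsets of $\mathbb{R}^p$ containing algebraic sets, stable under products with $\mathbb{R}$ and coordinate projections, whose subsets of $\mathbb{R}$ are exactly finite unions of intervals and points. *)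

(* Defs.v *)
From HB Require Import structures.
From mathcomp Require Import all_boot all_order all_algebra.
From mathcomp Require Import all_classical all_reals all_analysis.
From mathcomp Require mpoly.
Set Implicit Arguments. Unset Strict Implicit. Unset Printing Implicit Defensive.
Import Order.TTheory GRing.Theory Num.Theory.
Import numFieldNormedType.Exports.
Local Open Scope classical_set_scope.
Local Open Scope ring_scope.

Section Defs.
Variable R : realType.

Definition algebraic_set (n : nat) (P : mpoly.mpoly n R) : set 'rV[R]_n :=
  [set x | mpoly.meval (fun i => x ord0 i) P = 0].

Definition o_minimal (S : forall n : nat, set (set 'rV[R]_n)) : Prop :=
  (forall n, S n set0) /\
  (forall n A, S n A -> S n (~` A)) /\
  (forall n A B, S n A -> S n B -> S n (A `|` B)) /\
  (forall n (P : mpoly.mpoly n R), S n (algebraic_set P)) /\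
  (forall n (A : set 'rV[R]_n), S n A ->
      S (n + 1)%N [set z | A (lsubmx z)] /\ S (1 + n)%N [set z | A (rsubmx z)]) /\
  (forall n (A : set 'rV[R]_(n + 1)), S (n + 1)%N A ->
      S n (@lsubmx R 1 n 1 @` A)) /\
  (* definable subsets of R are exactly the finite unions of intervals and
     points (points being degenerate closed intervals [a, a]) *)
  (forall A : set 'rV[R]_1, S 1%N A <->
      exists s : seq (interval R),
        A = [set x | exists2 I, I \in s & x ord0 ord0 \in I]).

Definition definable_fun (S : forall n : nat, set (set 'rV[R]_n)) (p : nat)
    (f : 'rV[R]_p -> R) : Prop :=
  S (p + 1)%N [set z | f (lsubmx z) = rsubmx z ord0 ord0].

Definition definable_setmap (S : forall n : nat, set (set 'rV[R]_n)) (p : nat)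
    (D : 'rV[R]_p -> set 'rV[R]_p) : Prop :=
  S (p + p)%N [set z | D (lsubmx z) (rsubmx z)].

Definition dotp (p : nat) (u v : 'rV[R]_p) : R := \sum_i u ord0 i * v ord0 i.

Definition abs_continuous01 (p : nat) (g : R -> 'rV[R]_p) : Prop :=
  forall e : R, 0 < e -> exists2 d : R, 0 < d &
    forall (k : nat) (a b : 'I_k -> R),
      (forall i, 0 <= a i /\ a i <= b i /\ b i <= 1) ->
      (forall i j, i != j -> b i <= a j \/ b j <= a i) ->
      \sum_i (b i - a i) < d ->
      \sum_i `|g (b i) - g (a i)| < e.

Definition support_integrand (p : nat) (D : 'rV[R]_p -> set 'rV[R]_p)
    (g : R -> 'rV[R]_p) (t : R) : \bar R :=
  ereal_sup [set (dotp (derive1 g t) v)%:E | v in D (g t)].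

Definition path_integral (p : nat) (D : 'rV[R]_p -> set 'rV[R]_p)
    (g : R -> 'rV[R]_p) : \bar R :=
  (\int[lebesgue_measure]_(t in `[(0:R)%R, (1:R)%R]) support_integrand D g t)%E.

Definition conservative_field (p : nat) (D : 'rV[R]_p -> set 'rV[R]_p) : Prop :=
  [/\ closed [set xv : 'rV[R]_p * 'rV[R]_p | D xv.1 xv.2],
      (forall x, D x !=set0 /\ compact (D x)) &
      (forall g : R -> 'rV[R]_p, abs_continuous01 g -> g 0 = g 1 ->
          path_integral D g = 0%E)].

Definition conservative_field_for (p : nat) (D : 'rV[R]_p -> set 'rV[R]_p)
    (f : 'rV[R]_p -> R) : Prop :=
  conservative_field D /\
  forall (x : 'rV[R]_p) (g : R -> 'rV[R]_p),
    abs_continuous01 g -> g 0 = 0 -> g 1 = x ->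
    (f x)%:E = ((f 0)%:E + path_integral D g)%E.

End Defs.

(* Main.v *)
(* If 0 is in [D] along a Lipschitz curve, the integrand of the path integral is
   nonnegative there, and so it is for the reversed curve: [f] is constant along
   Lipschitz curves of critical points.

   The set of critical values is definable; if it were infinite it would contain
   an interval. Over that interval a critical point [x(t)] with [f(x(t)) = t] can
   be chosen one coordinate at a time, each coordinate being Lipschitz in [t] on a
   smaller interval, which contradicts the first paragraph. Each shrinking of the
   interval uses that, when countably many definable sets cover an interval, one
   of them is uncountable and hence contains an interval. Applied to the sets of
   [t] for which a given rational is a possible value, together with the set of
   [t] for which there is a least possible value, it yields definable choice; with
   sets indexed by the radius 1/(n+1) on which a one-sided comparison holds, it
   yields monotonicity and then the Lipschitz property. *)
Require Import Defs.
From HB Require Import structures.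
From mathcomp Require Import all_boot all_order all_algebra.
From mathcomp Require Import all_classical all_reals all_analysis.
From mathcomp Require Import lra.
From mathcomp Require Import(canonicals) mpoly.
Import Order.TTheory GRing.Theory Num.Theory.
Import numFieldNormedType.Exports.
Local Open Scope classical_set_scope.
Local Open Scope ring_scope.
Set Implicit Arguments. Unset Strict Implicit. Unset Printing Implicit Defensive.

(** * Definable predicates *)

Section definable_predicates.
Variables (R : realType) (S : forall n : nat, set (set 'rV[R]_n)).
Hypothesis omS : o_minimal S.
Implicit Types (P Q : (nat -> R) -> Prop) (e x : nat -> R).

(** Entries beyond the dimension are filled with 0; predicates local to the first [n] entries never
    see this default. *)
Definition rvenv n (x : 'rV[R]_n) : nat -> R :=
  fun i => oapp (fun j : 'I_n => x ord0 j) 0 (insub i).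

Lemma rvenv_ord n (x : 'rV[R]_n) (j : 'I_n) : rvenv x j = x ord0 j.
Proof. by rewrite /rvenv valK. Qed.

Lemma row_rvenv n (x : 'rV[R]_n) : \row_j rvenv x j = x.
Proof. by apply/rowP => j; rewrite mxE rvenv_ord. Qed.

Lemma rvenv_lsubmx n m (z : 'rV[R]_(n + m)) i : (i < n)%N ->
  rvenv (lsubmx z) i = rvenv z i.
Proof.
move=> ltin; have -> : i = Ordinal ltin by [].
by rewrite rvenv_ord mxE -rvenv_ord.
Qed.

Lemma rvenv_rsubmx n m (z : 'rV[R]_(n + m)) i : (i < m)%N ->
  rvenv (rsubmx z) i = rvenv z (n + i)%N.
Proof.
move=> ltim; have -> : i = Ordinal ltim by [].
by rewrite rvenv_ord mxE -rvenv_ord.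
Qed.

(* Predicates live on environments [nat -> R], of which only the first [n]
   entries matter, so that changing the dimension needs no cast. *)
Definition dfn_in n P : Prop :=
  (forall e e', (forall i, (i < n)%N -> e i = e' i) -> P e -> P e') /\
  S [set x : 'rV[R]_n | P (rvenv x)].

Lemma dfn_in_set n (A : set 'rV[R]_n) : S A ->
  dfn_in n (fun e => A (\row_(i < n) e i)).
Proof.
move=> SA; split=> [e e' ee'|].
  suff -> : \row_(i < n) e i = \row_(i < n) e' i by [].
  by apply/rowP => i; rewrite !mxE ee'.
rewrite (_ : [set x | _] = A) //; apply/seteqP.
by split=> x /=; rewrite row_rvenv.
Qed.

Lemma eq_dfn_in n P Q : (forall e, P e <-> Q e) -> dfn_in n P -> dfn_in n Q.
Proof. by move=> PQ; suff -> : P = Q by []; apply/predeqP. Qed.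

Lemma dfn_in_not n P : dfn_in n P -> dfn_in n (fun e => ~ P e).
Proof.
case=> loc SP; split=> [e e' ee' nPe Pe'|]; last exact: omS.2.1.
by apply: nPe; apply: loc Pe' => i ltin; rewrite ee'.
Qed.

Lemma dfn_in_or n P Q : dfn_in n P -> dfn_in n Q ->
  dfn_in n (fun e => P e \/ Q e).
Proof.
move=> [lP SP] [lQ SQ]; split; last exact: omS.2.2.1.
by move=> e e' ee' [/(lP _ _ ee')|/(lQ _ _ ee')]; [left|right].
Qed.

Lemma dfn_inS n P : dfn_in n P -> dfn_in n.+1 P.
Proof.
case=> loc SP; split=> [e e' ee'|].
  by apply: loc => i ltin; apply: ee'; exact: ltnW.
have [+ _] := omS.2.2.2.2.1 _ _ SP.
rewrite [X in S X](_ : _ = [set z : 'rV_(n + 1) | P (rvenv z)]); last first.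
  apply/seteqP; split=> z /=; apply: loc => i ltin;
  by rewrite rvenv_lsubmx.
by rewrite addn1.
Qed.

Lemma dfn_in_leq n m P : (n <= m)%N -> dfn_in n P -> dfn_in m P.
Proof.
by move/subnK <-; elim: (m - n)%N => // k IHk /IHk; exact: dfn_inS.
Qed.

Lemma dfn_in_shift n P : dfn_in n P -> dfn_in n.+1 (fun e => P (e \o succn)).
Proof.
case=> loc SP; split=> [e e' ee'|].
  by apply: loc => i ltin; apply: ee'.
have [_ +] := omS.2.2.2.2.1 _ _ SP.
rewrite [X in S X](_ : _ = [set z : 'rV_(1 + n) | P (rvenv z \o succn)]) //.
apply/seteqP; split=> z /=; apply: loc => i ltin;
by rewrite rvenv_rsubmx.
Qed.

(** The projection axiom removes the last coordinate, so the bound variable sits at position [n]. *)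
Lemma dfn_in_exlast n P : dfn_in n.+1 P ->
  dfn_in n (fun e => exists y, P (fun i => if i == n then y else e i)).
Proof.
case=> loc SP; split=> [e e' ee' [y Py]|].
  exists y; apply: loc Py => i; rewrite ltnS leq_eqVlt.
  by case: eqP => //= _ /ee'.
have {SP} : S [set z : 'rV_(n + 1) | P (rvenv z)] by rewrite addn1.
move=> /omS.2.2.2.2.2.1.
rewrite [X in S X](_ : _ = [set x : 'rV_n |
   exists y, P (fun i => if i == n then y else rvenv x i)]) //.
apply/seteqP; split=> x /=.
  move=> [z Pz <-]; exists (rvenv z n); apply: loc Pz => i.
  by rewrite ltnS leq_eqVlt; case: eqP => [->//|_ /= ltin]; rewrite rvenv_lsubmx.
move=> [y Py]; exists (row_mx x (\row_(j < 1) y)); last by rewrite row_mxKl.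
apply: loc Py => i; rewrite ltnS leq_eqVlt; case: eqP => [->//|_ /= ltin].
  have := @rvenv_rsubmx n 1 (row_mx x (\row_(j < 1) y)) 0 isT.
  by rewrite row_mxKr addn0 => <-; rewrite (rvenv_ord _ (@ord0 0)) mxE.
by rewrite -(@rvenv_lsubmx n 1) // row_mxKl.
Qed.

Lemma dfn_in_exs m k P : dfn_in (m + k) P ->
  dfn_in m (fun e => exists x, P (fun i => if (i < m)%N then e i else x i)).
Proof.
elim: k P => [P|k IHk P].
  rewrite addn0 => dP; apply: eq_dfn_in (dP) => e; split.
    move=> Pe; exists (fun=> 0); apply: dP.1 Pe => i ltim.
    by rewrite ltim.
  by move=> [x]; apply: dP.1 => i ->.
rewrite addnS => dP; apply: eq_dfn_in (IHk _ (dfn_in_exlast dP)) => e.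
split=> [[x [y Pxy]]|[x Px]].
  exists (fun i => if i == (m + k)%N then y else x i); apply: dP.1 Pxy => i _.
  by case: eqP => // ->; rewrite ltnNge leq_addr.
exists x, (x (m + k)%N); apply: dP.1 Px => i _.
by case: eqP => // ->; rewrite ltnNge leq_addr.
Qed.

Definition dfn P := exists n, dfn_in n P.

Lemma eq_dfn P Q : (forall e, P e <-> Q e) -> dfn P -> dfn Q.
Proof. by move=> PQ [n dP]; exists n; exact: eq_dfn_in dP. Qed.

Lemma dfn_set n (A : set 'rV[R]_n) : S A -> dfn (fun e => A (\row_(i < n) e i)).
Proof. by exists n; exact: dfn_in_set. Qed.

Lemma dfn_not P : dfn P -> dfn (fun e => ~ P e).
Proof. by move=> [n dP]; exists n; exact: dfn_in_not. Qed.

Lemma dfn_or P Q : dfn P -> dfn Q -> dfn (fun e => P e \/ Q e).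
Proof.
move=> [n dP] [m dQ]; exists (maxn n m); apply: dfn_in_or.
- exact: dfn_in_leq (leq_maxl _ _) dP.
- exact: dfn_in_leq (leq_maxr _ _) dQ.
Qed.

Lemma dfn_and P Q : dfn P -> dfn Q -> dfn (fun e => P e /\ Q e).
Proof.
move=> dP dQ; have := dfn_not (dfn_or (dfn_not dP) (dfn_not dQ)).
apply: eq_dfn => e; split=> [/not_orP[/contrapT Pe /contrapT Qe]//|[Pe Qe]].
by case.
Qed.

Lemma dfn_imp P Q : dfn P -> dfn Q -> dfn (fun e => P e -> Q e).
Proof.
move=> dP dQ; apply: eq_dfn (dfn_or (dfn_not dP) dQ) => e.
by split=> [[]//|PQ]; have [/PQ|] := EM (P e); [right|left].
Qed.

Lemma dfn_poly n (p : mpoly.mpoly n R) :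
  dfn (fun e => mpoly.meval (fun i : 'I_n => e i) p = 0).
Proof.
exists n; apply: eq_dfn_in (dfn_in_set (omS.2.2.2.1 _ p)) => e.
rewrite /algebraic_set /=; set u := mpoly.meval _ _; set v := mpoly.meval _ _.
suff -> : u = v by [].
by apply: mpoly.meval_eq => i; rewrite mxE.
Qed.

Definition mvar n (i : 'I_n) : mpoly.mpoly n R := mpoly.mpolyX R (mpoly.mnm1 i).

Lemma meval_mvar n (i : 'I_n) (v : 'I_n -> R) : mpoly.meval v (mvar i) = v i.
Proof. exact: mpoly.mevalXU. Qed.

Lemma dfn_eq_var i j : dfn (fun e => e i = e j).
Proof.
have li : (i < (i + j).+1)%N by rewrite ltnS leq_addr.
have lj : (j < (i + j).+1)%N by rewrite ltnS leq_addl.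
apply: eq_dfn (dfn_poly (mvar (Ordinal li) - mvar (Ordinal lj))) => e.
by rewrite mpoly.mevalB !meval_mvar /=; split => [/subr0_eq|->] //; rewrite subrr.
Qed.

Lemma dfn_eq_cst i (c : R) : dfn (fun e => e i = c).
Proof.
apply: eq_dfn (dfn_poly (mvar (@ord_max i) - mpoly.mpolyC _ c)) => e.
rewrite mpoly.mevalB !meval_mvar mpoly.mevalC /=.
by split => [/subr0_eq|->] //; rewrite subrr.
Qed.

Lemma dfn_true : dfn (fun=> True).
Proof. by apply: eq_dfn (dfn_eq_var 0 0) => e. Qed.

Lemma dfn_all n (F : nat -> (nat -> R) -> Prop) : (forall i, dfn (F i)) ->
  dfn (fun e => forall i, (i < n)%N -> F i e).
Proof.
move=> dF; elim: n => [|n IHn]; first by apply: eq_dfn dfn_true => e.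
apply: eq_dfn (dfn_and IHn (dF n)) => e; split=> [[IH Fn] i|allF].
  by rewrite ltnS leq_eqVlt => /orP[/eqP->//|/IH].
by split=> [i ltin|]; apply: allF => //; exact: ltnW.
Qed.

Lemma dfn_shift m P : dfn P -> dfn (fun e => P (fun i => e (m + i)%N)).
Proof.
elim: m => [//|m IHm] /IHm [n dP]; exists n.+1.
by apply: eq_dfn_in (dfn_in_shift dP) => e /=.
Qed.

Lemma dfn_exs m P : dfn P ->
  dfn (fun e => exists x, P (fun i => if (i < m)%N then e i else x i)).
Proof.
move=> [n dP]; exists m; apply: (@dfn_in_exs _ n).
exact: dfn_in_leq (leq_addl _ _) dP.
Qed.

(* Fresh copies of the variables read by [P] are placed beyond position [m],
   equated with the entries selected by [s], and projected away. *)
Lemma dfn_subst (s : nat -> nat) P : dfn P -> dfn (fun e => P (e \o s)).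
Proof.
move=> [n dP]; pose m := (\max_(i < n) s i).+1.
have sm i : (i < n)%N -> (s i < m)%N.
  by move=> ltin; rewrite ltnS (leq_bigmax (Ordinal ltin)).
have dP' : dfn P by exists n.
have dQ : dfn (fun e => forall i, (i < n)%N -> e (m + i)%N = e (s i)).
  by apply: dfn_all => i; exact: dfn_eq_var.
apply: eq_dfn (dfn_exs m (dfn_and (dfn_shift m dP') dQ)) => e; split.
  move=> [x [Px xs]]; apply: dP.1 Px => i ltin /=.
  by rewrite ltnNge leq_addr /=; have := xs i ltin; rewrite ltnNge leq_addr sm.
move=> Pes; exists (fun i => e (s (i - m)%N)); split.
  by apply: dP.1 Pes => i ltin /=; rewrite ltnNge leq_addr /= addKn.
by move=> i ltin; rewrite ltnNge leq_addr /= addKn sm.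
Qed.

(** Bound variables follow the de Bruijn convention: the new one is at position 0 and the others
    move up by one. For the projection it is renamed to position [n], out of the way of all the
    parameters read. *)
Lemma dfn_ex (Q : R -> (nat -> R) -> Prop) :
  dfn (fun e => Q (e 0%N) (fun i => e i.+1)) -> dfn (fun e => exists y, Q y e).
Proof.
move=> [n dQ]; have dQ' : dfn (fun e => Q (e 0%N) (fun i => e i.+1)) by exists n.
have := dfn_exs n (dfn_subst (fun i => if i is j.+1 then j else n) dQ').
apply: eq_dfn => e /=; split=> [[x Qx]|[y Qy]].
  exists (x n); move: Qx; rewrite ltnn.
  apply: (dQ.1 (fun i => if i is j.+1 then if (j < n)%N then e j else x j
                         else x n) (fun i => if i is j.+1 then e j else x n)).
  by move=> -[|i] //= ltin; rewrite ltnW.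
exists (fun=> y); rewrite ltnn.
apply: (dQ.1 (fun i => if i is j.+1 then e j else y)
  (fun i => if i is j.+1 then if (j < n)%N then e j else y else y)) Qy.
by move=> -[|i] //= ltin; rewrite ltnW.
Qed.

Lemma dfn_fa (Q : R -> (nat -> R) -> Prop) :
  dfn (fun e => Q (e 0%N) (fun i => e i.+1)) -> dfn (fun e => forall y, Q y e).
Proof.
move=> dQ; have := dfn_not (dfn_ex (Q := fun y e => ~ Q y e) (dfn_not dQ)).
apply: eq_dfn => e; split=> [/forallNP nQ y|Qe [y]]; last exact.
exact: contrapT (nQ y).
Qed.

(** * Definable terms and relations between them *)

Definition dterm (t : (nat -> R) -> R) :=
  dfn (fun e => e 0%N = t (fun i => e i.+1)).

Lemma dterm_var i : dterm (fun e => e i).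
Proof. exact: dfn_eq_var. Qed.

Lemma dterm_cst c : dterm (fun=> c).
Proof. exact: dfn_eq_cst. Qed.

Lemma dfn_add3 : dfn (fun e => e 0%N = e 1%N + e 2%N).
Proof.
pose i0 := @Ordinal 3 0 isT; pose i1 := @Ordinal 3 1 isT.
pose i2 := @Ordinal 3 2 isT.
apply: eq_dfn (dfn_poly (mvar i0 - (mvar i1 + mvar i2))) => e.
rewrite mpoly.mevalB mpoly.mevalD !meval_mvar /=.
by split => [/subr0_eq|->] //; rewrite subrr.
Qed.

Lemma dfn_mul3 : dfn (fun e => e 0%N = e 1%N * e 2%N).
Proof.
pose i0 := @Ordinal 3 0 isT; pose i1 := @Ordinal 3 1 isT.
pose i2 := @Ordinal 3 2 isT.
apply: eq_dfn (dfn_poly (mvar i0 - (mvar i1 * mvar i2))) => e.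
rewrite mpoly.mevalB mpoly.mevalM !meval_mvar /=.
by split => [/subr0_eq|->] //; rewrite subrr.
Qed.

Lemma dterm_app2 (op : R -> R -> R) (t u : (nat -> R) -> R) :
  dfn (fun e => e 0%N = op (e 1%N) (e 2%N)) -> dterm t -> dterm u ->
  dterm (fun e => op (t e) (u e)).
Proof.
move=> dop dt du.
(* Under the two quantifiers [z] is at position 0, [y] at 1, the result at 2, and the parameters
   start at 3. *)
pose st i := if i is j.+1 then j.+3 else 1%N.
pose su i := if i is j.+1 then j.+3 else 0%N.
pose so i := nth 0%N [:: 2; 1; 0]%N i.
apply: (eq_dfn (P := fun e => exists y z, [/\ y = t (fun i => e i.+1),
    z = u (fun i => e i.+1) & e 0%N = op y z])) => [e|].
  by split=> [[y [z [-> -> ->]]]|->] //; exists (t (fun i => e i.+1)),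
    (u (fun i => e i.+1)).
apply: dfn_ex; apply: dfn_ex; apply: eq_dfn (dfn_and (dfn_subst st dt)
  (dfn_and (dfn_subst su du) (dfn_subst so dop))) => e /=.
by split=> [[-> [-> ->]]|[-> -> ->]].
Qed.

Lemma dtermD (t u : (nat -> R) -> R) : dterm t -> dterm u ->
  dterm (fun e => t e + u e).
Proof. exact: dterm_app2 dfn_add3. Qed.

Lemma dtermM (t u : (nat -> R) -> R) : dterm t -> dterm u ->
  dterm (fun e => t e * u e).
Proof. exact: dterm_app2 dfn_mul3. Qed.

Lemma dtermB (t u : (nat -> R) -> R) : dterm t -> dterm u ->
  dterm (fun e => t e - u e).
Proof.
move=> dt du; rewrite (_ : (fun e => _) = (fun e => t e + -1 * u e)).
  by apply: dtermD => //; apply: dtermM => //; exact: dterm_cst.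
by apply/funext => e; rewrite mulN1r.
Qed.

Lemma dfn_rel2 (G : R -> R -> Prop) (t u : (nat -> R) -> R) :
  dfn (fun e => G (e 0%N) (e 1%N)) -> dterm t -> dterm u ->
  dfn (fun e => G (t e) (u e)).
Proof.
move=> dG dt du; apply: (eq_dfn (P := fun e => exists y z, [/\ y = t e,
    z = u e & G y z])) => [e|].
  by split=> [[y [z [-> ->]]]|Gtu] //; exists (t e), (u e).
apply: dfn_ex; apply: dfn_ex.
pose st i := if i is j.+1 then j.+2 else 1%N.
pose su i := if i is j.+1 then j.+2 else 0%N.
pose so i := if i is 0%N then 1%N else 0%N.
apply: eq_dfn (dfn_and (dfn_subst st dt)
  (dfn_and (dfn_subst su du) (dfn_subst so dG))) => e /=.
by split=> [[-> [-> ?]]|[-> -> ?]].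
Qed.

Lemma dfn_eq (t u : (nat -> R) -> R) : dterm t -> dterm u ->
  dfn (fun e => t e = u e).
Proof. by apply: (@dfn_rel2 eq); exact: dfn_eq_var. Qed.

(** The order comes from the ring operations: a real number is nonnegative iff it is a square. *)
Lemma dfn_le (t u : (nat -> R) -> R) : dterm t -> dterm u ->
  dfn (fun e => t e <= u e).
Proof.
move=> dt du; refine (dfn_rel2 (G := fun y z : R => y <= z) _ dt du).
apply: (eq_dfn (P := fun e => exists z, e 1%N = e 0%N + z * z)) => [e|].
  split=> [[z ->]|le01]; first by rewrite lerDl -expr2 sqr_ge0.
  by exists (Num.sqrt (e 1%N - e 0%N)); rewrite -expr2 sqr_sqrtr ?subr_ge0 // subrKC.
by apply: dfn_ex; apply: dfn_eq; [|apply: dtermD; [|apply: dtermM]]; exact: dterm_var.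
Qed.

Lemma dfn_lt (t u : (nat -> R) -> R) : dterm t -> dterm u ->
  dfn (fun e => t e < u e).
Proof.
move=> dt du; apply: eq_dfn (dfn_not (dfn_le du dt)) => e.
by split=> [/negP|?]; [rewrite -ltNge|apply/negP; rewrite -ltNge].
Qed.

Definition unions_of_intervals (A : set R) : Prop :=
  exists s : seq (interval R), A = [set x : R | exists2 I, I \in s & x \in I].

(** Real parameters are allowed because constants are definable: the relevant positions after 0 are
    equated with entries of [e], then all but position 0 are projected away. *)
Lemma dfn_fiber P e : dfn P ->
  unions_of_intervals [set y | P (fun i => if i is j.+1 then e j else y)].
Proof.
move=> [n dP]; have dP' : dfn P by exists n.
have dQ : dfn (fun z => forall i, (i < n)%N -> (0 < i)%N -> z i = e i.-1).
  by apply: dfn_all => -[|i]; apply: dfn_imp; try exact: dfn_eq_cst;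
    [apply: eq_dfn (dfn_not dfn_true) | apply: eq_dfn dfn_true].
have [m dPQ] := dfn_and dP' dQ.
have [loc] := @dfn_in_exs 1 m _ (dfn_in_leq (leq_addl _ _) dPQ).
move=> /omS.2.2.2.2.2.2[s sE]; exists s; apply/seteqP.
have sE' y : [set x : 'rV[R]_1 | exists x0, P (fun i => if (i < 1)%N then rvenv x i else x0 i)
      /\ forall i, (i < n)%N -> (0 < i)%N -> (if (i < 1)%N then rvenv x i else x0 i) = e i.-1]
    (const_mx y) <-> P (fun i => if i is j.+1 then e j else y).
  have y0 : rvenv (const_mx y : 'rV[R]_1) 0 = y.
    by rewrite (rvenv_ord _ (@ord0 0)) mxE.
  split=> [[x [Px xe]]|Py].
    by apply: dP.1 Px => -[|i] //= ltin; exact: (xe i.+1).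
  exists (fun i => e i.-1); split; last by case.
  by apply: dP.1 Py => -[|i].
split=> y /=.
  by move/sE'; rewrite sE /= mxE.
by move=> Is; apply/sE'; rewrite sE /= mxE.
Qed.

End definable_predicates.

(** * Finite unions of intervals *)

Section unions_of_intervals.
Variable R : realType.
Implicit Types (A : set R) (a b x y z : R).

Lemma itv_convex (I : interval R) x y z : x \in I -> y \in I -> x <= z <= y ->
  z \in I.
Proof. by move=> xI yI xzy; exact: (@interval_is_interval _ I) xI yI _ xzy. Qed.

(** Each interval of the union either meets [J] in at most one point, or shares two points with [J]
    and by convexity contains everything between them. *)
Lemma unions_of_intervals_interior A (J : interval R) : unions_of_intervals A ->
  finite_set (A `&` [set` J]) \/
  exists a b, [/\ a < b, a \in J, b \in J & forall t, a < t < b -> A t].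
Proof.
case=> s ->; apply/or_asboolP; rewrite -implyNb; apply/implyP => /asboolPn nfin.
apply/asboolP; apply: contrapT => nint; apply: nfin.
elim: s nint => [_|I s IHs nint].
  by rewrite (_ : _ `&` _ = set0) //; apply/seteqP; split=> x // [[]].
apply: (@sub_finite_set _ _ (([set` I] `&` [set` J]) `|`
   ([set x | exists2 I, I \in s & x \in I] `&` [set` J]))).
  move=> x [[I' /[!inE] /orP[/eqP->|I's] xI'] xJ]; first by left.
  by right; split => //; exists I'.
rewrite finite_setU; split; last first.
  apply: IHs => -[a [b [ab aJ bJ abs]]]; apply: nint; exists a, b; split=> // t.
  by move=> /abs [I' I's tI']; exists I' => //; rewrite inE I's orbT.
have [[x [xI xJ]]|] := pselect (([set` I] `&` [set` J]) !=set0); last first.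
  by move=> /nonemptyPn ->.
apply: (@sub_finite_set _ _ [set x]); last exact: finite_set1.
move=> y [yI yJ] /=; apply: contrapT => /eqP; rewrite neq_lt => xy; apply: nint.
case/orP: xy => xy; [exists y, x|exists x, y]; split=> // t /andP[lt1 lt2];
  exists I; rewrite ?inE ?eqxx //.
- by apply: (itv_convex yI xI); rewrite !ltW.
- by apply: (itv_convex xI yI); rewrite !ltW.
Qed.

(** An interval that meets every right neighbourhood of [x] contains one, by convexity; finitely
    many radii have a positive minimum. *)
Lemma unions_of_intervals_right_germ A x : unions_of_intervals A ->
  exists2 d, 0 < d & (forall y, x < y < x + d -> A y) \/
                     (forall y, x < y < x + d -> ~ A y).
Proof.
case=> s ->; elim: s => [|I s [d d0 IHs]].
  by exists 1 => //; right=> y _ [].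
have [d' d'0 IH'] : exists2 d', 0 < d' & (forall y, x < y < x + d' -> y \in I) \/
                     (forall y, x < y < x + d' -> ~ y \in I).
  have [[d' d'0 dI]|] := pselect (exists2 d', 0 < d' &
      forall y, x < y < x + d' -> ~ y \in I); first by exists d' => //; right.
  move=> H; have {}H d' : 0 < d' -> exists2 y, x < y < x + d' & y \in I.
    move=> d'0; apply: contrapT => nex; apply: H; exists d' => // y xy yI.
    by apply: nex; exists y.
  have [y /andP[xy _] yI] := H _ ltr01.
  exists (y - x); first by rewrite subr_gt0.
  left=> z /andP[xz]; rewrite subrKC => zy.
  have [|w /andP[xw]] := H (z - x); first by rewrite subr_gt0.
  by rewrite subrKC => wz wI; apply: (itv_convex wI yI); rewrite !ltW.
exists (Num.min d d'); first by rewrite lt_min d0.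
have sub y : x < y < x + Num.min d d' -> x < y < x + d /\ x < y < x + d'.
  by rewrite -ltrBlDl lt_min !ltrBlDl => /and3P[-> -> ->].
case: IH' => [IH'|IH'].
  by left=> y /sub[_ /IH' yI]; exists I; rewrite ?inE ?eqxx.
case: IHs => IHs; [left|right] => y /sub[yd yd'].
  by have [I' I's yI'] := IHs _ yd; exists I'; rewrite ?inE ?I's ?orbT.
by move=> [I' /[!inE] /orP[/eqP->|I's] yI']; [exact: IH' yI'|apply: (IHs _ yd); exists I'].
Qed.

(* A countable family of sets with finitely many components covering an interval
   cannot consist of finite sets only; this replaces the uniform finiteness
   arguments of general o-minimality. *)
Lemma countable_cover_interior (T : countType) (X : T -> set R) a b : a < b ->
  (forall i, unions_of_intervals (X i)) ->
  (forall t, a < t < b -> exists i, X i t) ->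
  exists i a' b', [/\ a <= a', a' < b', b' <= b &
    forall t, a' < t < b' -> X i t].
Proof.
move=> ab uX cover; apply: contrapT => nex.
have fin i : finite_set (X i `&` [set` `]a, b[]).
  have [//|[a' [b' [a'b' + + X']]]] := unions_of_intervals_interior `]a, b[ (uX i).
  rewrite !in_itv /= => /andP[aa' _] /andP[_ b'b].
  by exfalso; apply: nex; exists i, a', b'; split; rewrite // ltW.
have cnt : countable (\bigcup_i (X i `&` [set` `]a, b[])).
  by apply: bigcup_countable => // i _; exact/finite_set_countable/fin.
have : countable [set` `]a, b[].
  apply: sub_countable cnt; apply: subset_card_le => t /= tab.
  have [i Xi] : exists i, X i t by apply: cover; move: tab; rewrite in_itv.
  by exists i.
move=> /countable_lebesgue_measure0; rewrite lebesgue_measure_itv /= lte_fin ab.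
by move/eqP; rewrite -EFinB eqe subr_eq0 gt_eqF.
Qed.

(** Either the set contains an open interval, hence a rational, or it is finite. This leaves
    countably many ways of choosing a point. *)
Lemma rational_or_min A : unions_of_intervals A -> A !=set0 ->
  (exists q : rat, A (ratr q)) \/ exists2 y, A y & forall z, A z -> y <= z.
Proof.
move=> uA A0; have [fA|[a [b [ab _ _ abA]]]] :=
    unions_of_intervals_interior `]-oo, +oo[ uA; last first.
  by left; have [q] := rat_in_itvoo ab; rewrite in_itv => /abA; exists q.
right; move: fA; rewrite set_itvE setIT => /finite_seqP[s As].
move: A0 => [y0 Ay0]; rewrite As /= in Ay0.
have : exists2 y, y \in s & forall z, z \in s -> y <= z.
  elim: s y0 Ay0 {As} => // w s IHs y0 _.
  case: s IHs => [_|v s IHs]; first by exists w; rewrite ?inE // => z; rewrite inE => /eqP->.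
  have [y ys ymin] := IHs v (mem_head _ _).
  have [wy|yw] := leP w y; [exists w|exists y]; rewrite ?mem_head //.
  - by move=> z; rewrite inE => /orP[/eqP->//|/ymin]; exact: le_trans.
  - by rewrite inE ys orbT.
  - by move=> z; rewrite inE => /orP[/eqP->|/ymin//]; exact: ltW.
by rewrite As.
Qed.

End unions_of_intervals.

(** * Definable choice and Lipschitz selections *)

Section definable_curves.
Variables (R : realType) (S : forall n : nat, set (set 'rV[R]_n)).
Hypothesis omS : o_minimal S.
Implicit Types (a b t : R) (A G : R -> R -> Prop).

Local Notation dfn2 A := (dfn S (fun e => A (e 0%N) (e 1%N))).

(** Definability is derived from the syntax of the predicate; [hyp] is the definability of the one
    binary relation that is not arithmetic. *)
Ltac dfn_step hyp :=
  lazymatch goal with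
  | |- dfn _ (fun e => forall x : Real.sort _, _) => refine (dfn_fa omS _)
  | |- dfn _ (fun e => exists x : Real.sort _, _) => refine (dfn_ex omS _)
  | |- dfn _ (fun e => _ /\ _) => refine (dfn_and omS _ _)
  | |- dfn _ (fun e => ~ _) => refine (dfn_not omS _)
  | |- dfn _ (fun e => is_true (_ < _)) => refine (dfn_lt omS _ _)
  | |- dfn _ (fun e => is_true (_ <= _)) => refine (dfn_le omS _ _)
  | |- dfn _ (fun e => _ = _) => refine (dfn_eq omS _ _)
  | |- dfn _ (fun e => _ -> _) => refine (dfn_imp omS _ _)
  | |- dfn _ (fun e => _ _ _) => refine (dfn_rel2 omS hyp _ _)
  | |- dterm _ (fun e => _ + - _) => refine (dtermB omS _ _)
  | |- dterm _ (fun e => _ + _) => refine (dtermD omS _ _)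
  | |- dterm _ (fun e => _ * _) => refine (dtermM omS _ _)
  | |- dterm _ (fun e => e _) => exact: (dterm_var omS)
  | |- dterm _ (fun=> _) => exact: (dterm_cst omS)
  end; cbv beta.

Ltac dfn_auto hyp := cbv beta; repeat (dfn_step hyp).

(** Functions are kept as graphs, since definability concerns relations; being single-valued is
    global, while totality is asked on an interval only. *)
Definition functional G := forall t y y', G t y -> G t y' -> y = y'.

Definition total_on a b G := forall t, a < t < b -> exists y, G t y.

Lemma dfn_section (P : R -> Prop) : dfn S (fun e => P (e 0%N)) ->
  unions_of_intervals [set y | P y].
Proof. exact: (dfn_fiber omS (fun=> 0)). Qed.

Lemma definable_choice A a b : a < b -> dfn2 A -> total_on a b A ->
  exists a' b' G, [/\ a <= a', a' < b', b' <= b &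
    [/\ dfn2 G, functional G, total_on a' b' G & forall t y, G t y -> A t y]].
Proof.
move=> ab dA totA.
pose X (o : option rat) : set R := if o is Some q then [set t | A t (ratr q)]
  else [set t | exists y, A t y /\ forall z, A t z -> y <= z].
have uX o : unions_of_intervals (X o).
  by case: o => [q|]; apply: dfn_section; dfn_auto dA.
have [|o [a' [b' [aa' a'b' b'b X']]]] := countable_cover_interior ab uX.
  move=> t /totA [y Aty].
  have uA : unions_of_intervals [set y | A t y].
    by apply: dfn_section; dfn_auto dA.
  have [|[q Aq]|[z Az minz]] := rational_or_min uA; first by exists y.
    by exists (Some q).
  by exists None, z.
case: o X' => [q|] /= X'.
  exists a', b', (fun t y => y = ratr q /\ A t y); split=> //; split.
  - by dfn_auto dA.
  - by move=> t y y' [-> _] [-> _].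
  - by move=> t /X' At; exists (ratr q).
  - by move=> t y [].
exists a', b', (fun t y => A t y /\ forall z, A t z -> y <= z); split=> //; split.
- by dfn_auto dA.
- by move=> t y y' [Ay miny] [Ay' miny']; apply/le_anti; rewrite miny ?miny'.
- by move=> t /X'.
- by move=> t y [].
Qed.

(** * Monotonicity and Lipschitz bounds for definable functions of one variable *)

Definition nondecreasing_graph a b G := forall t t' y y',
  a < t -> t < t' -> t' < b -> G t y -> G t' y' -> y <= y'.

Definition lipschitz_graph L a b G := forall t t' y y',
  a < t -> t < t' -> t' < b -> G t y -> G t' y' -> `|y' - y| <= L * (t' - t).

Lemma harmonic_below (d : R) : 0 < d -> exists n : nat, n.+1%:R^-1 <= d.
Proof.
move=> d0; exists (Num.truncn d^-1); rewrite -[leRHS]invrK lef_pV2 ?posrE ?invr_gt0 ?ltr0n //.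
by apply/ltW/truncnS_gt.
Qed.

(** The right germ at [x] of the comparison with the value at [x] is constant. The covering sets are
    indexed by the radius and the direction of that comparison. *)
Lemma definable_monotone G a b : a < b -> dfn2 G -> functional G ->
  total_on a b G ->
  exists a' b', [/\ a <= a', a' < b', b' <= b &
    nondecreasing_graph a' b' G \/ nondecreasing_graph a' b' (fun t y => G t (- y))].
Proof.
move=> ab dG fG totG.
pose le (s : bool) (u v : R) := if s then u <= v else v <= u.
pose X (i : nat * bool) : set R := [set x | forall z u v, x < z -> z < x + i.1.+1%:R^-1 ->
  G x u -> G z v -> le i.2 u v].
have uX i : unions_of_intervals (X i).
  by case: i => n []; rewrite /X /le /=; apply: dfn_section; dfn_auto dG.
have [|[n s] [a' [b' [aa' a'b' b'b X']]]] := countable_cover_interior ab uX.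
  move=> x /andP[ax xb].
  have uA : unions_of_intervals [set z | forall u v, G x u -> G z v -> u <= v].
    by apply: dfn_section; dfn_auto dG.
  have [d d0 germ] := unions_of_intervals_right_germ x uA.
  have [|n nd] := @harmonic_below (Num.min d (b - x)).
    by rewrite lt_min d0 subr_gt0.
  move: nd; rewrite le_min => /andP[nd nb].
  case: germ => germ; [exists (n, true)|exists (n, false)] => z u v /= xz zn Gxu Gzv.
    by apply: germ Gzv => //; rewrite xz (lt_le_trans zn) // lerD2l.
  (* The negative germ denies [u <= v] for some pair of values at [x] and [z]; [G] being functional,
     that pair is the given one. *)
  apply: contrapT => /negP; rewrite -ltNge => /ltW uv.
  apply: (germ z); first by rewrite xz (lt_le_trans zn) // lerD2l.
  by move=> u' v' /(fG _ _ _ Gxu) <- /(fG _ _ _ Gzv) <-.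
(* Cut to length at most the radius, so that any two points of the interval are compared. *)
exists a', (Num.min b' (a' + n.+1%:R^-1)); split=> //.
- by rewrite lt_min a'b' ltrDl invr_gt0 ltr0n.
- by rewrite ge_min b'b.
have mono t t' u v : a' < t -> t < t' -> t' < Num.min b' (a' + n.+1%:R^-1) ->
    G t u -> G t' v -> le s u v.
  rewrite lt_min => a't tt' /andP[t'b' t'n]; apply: (X' t) => //=.
    by rewrite a't (lt_trans tt').
  by rewrite (lt_trans t'n) // ltrD2r.
case: s mono {X'} => mono; [left|right] => t t' u v /= a't tt' t'b' Gu Gv.
  exact: mono Gu Gv.
by rewrite -lerN2; exact: mono Gu Gv.
Qed.

(* A nondecreasing function cannot have unbounded right difference quotients at
   every point of an interval: by real induction its increments would exceed
   every multiple of the length. *)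
Lemma unbounded_slopes_absurd (h : R -> R) a b : a < b ->
  (forall t t', a < t -> t < t' -> t' < b -> h t <= h t') ->
  (forall x r, a < x < b -> 0 < r ->
     exists2 z, x < z < x + r & z - x < r * (h z - h x)) -> False.
Proof.
move=> ab mono slope.
(* The closed middle third lies inside the open interval, so both hypotheses on [h] hold up to its
   endpoints. *)
pose c := a + (b - a) / 3; pose d := a + (b - a) * 2 / 3.
have ac : a < c by rewrite /c; lra.
have cd : c < d by rewrite /c /d; lra.
have db : d < b by rewrite /d; lra.
(* More than the mean slope over [[c, d]], so [d] cannot belong to [E] below. *)
pose M := (h d - h c) / (d - c) + 1.
have M0 : 0 < M.
  by rewrite ltr_wpDl // divr_ge0 // subr_ge0 ?(ltW cd) // mono.
have ME : M * (d - c) = h d - h c + (d - c).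
  by rewrite mulrDl divfK ?mul1r // subr_eq0 gt_eqF.
pose E := [set y | c <= y <= d /\ M * (y - c) <= h y - h c].
have Ec : E c by split; rewrite ?lexx ?(ltW cd) // !subrr mulr0.
have ubE : ubound E d by move=> y [/andP[]].
have hsE : has_sup E by split; [exists c|exists d].
set s := sup E.
have cs : c <= s by apply: ub_le_sup => //; exact: hsE.2.
have sd : s <= d by apply: ge_sup => //; exists c.
have mono' t t' : a < t -> t <= t' -> t' < b -> h t <= h t'.
  by move=> at_; rewrite le_eqVlt => /orP[/eqP->//|]; exact: mono.
(* Monotonicity does the work of continuity: [h y <= h s] for every [y] in [E], so the bound passes
   to the supremum. *)
have Es : E s.
  split; first by rewrite cs.
  suff : s - c <= (h s - h c) / M by rewrite ler_pdivlMr // mulrC.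
  rewrite lerBlDr; apply: ge_sup; first by exists c.
  move=> y Ey; have ys : y <= s by apply: ub_le_sup => //; exact: hsE.2.
  case: Ey => /andP[cy yd] My; rewrite -lerBlDr ler_pdivlMr // mulrC.
  by rewrite (le_trans My) // lerD2r mono' ?(lt_le_trans ac) ?(le_lt_trans sd).
move: sd; rewrite le_eqVlt => /orP[/eqP sd|sd].
  by case: Es => _; rewrite sd ME; lra.
(* The radius keeps [z] below [d] and makes the slope from [s] to [z] exceed [M]; then [z] is in [E]
   beyond its supremum. *)
have [||z /andP[sz] zr zs] := slope s (Num.min (d - s) M^-1).
- by rewrite (lt_le_trans ac) ?(lt_trans sd).
- by rewrite lt_min subr_gt0 sd invr_gt0.
have zd : z < d.
  by rewrite (lt_le_trans zr) // -lerBrDl ge_min lexx.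
have hz : M * (z - s) < h z - h s.
  rewrite -ltr_pdivlMl // (lt_le_trans zs) // ler_wpM2r ?ge_min ?lexx ?orbT //.
  by rewrite subr_ge0 mono ?(lt_le_trans ac) ?(lt_trans zd).
suff Ez : E z by have := ub_le_sup hsE.2 Ez; rewrite leNgt -/s sz.
split; first by rewrite (le_trans cs) ?ltW.
by case: Es => _ Ms; rewrite (_ : z - c = (z - s) + (s - c)) ?mulrDr; lra.
Qed.

Lemma definable_lipschitz_nondecreasing G a b : a < b -> dfn2 G -> functional G ->
  total_on a b G -> nondecreasing_graph a b G ->
  exists a' b' L, [/\ a <= a', a' < b', b' <= b & lipschitz_graph L a' b' G].
Proof.
move=> ab dG fG totG mono.
(* A single [r] is both the radius and the inverse of the slope bound, so for nondecreasing [G] the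
   condition weakens as [r] shrinks. [None] collects the points with no such [r]. *)
pose B r : set R := [set x | forall z u v, x < z -> z < x + r ->
  G x u -> G z v -> r * (v - u) <= z - x].
pose X (o : option nat) : set R := if o is Some n then B n.+1%:R^-1
  else [set x | ~ exists r, 0 < r /\ B r x].
have uX o : unions_of_intervals (X o).
  by case: o => [n|]; rewrite /X /B /=; apply: dfn_section; dfn_auto dG.
have [|[n|] [a' [b' [aa' a'b' b'b X']]]] := countable_cover_interior ab uX.
- move=> x /andP[ax xb].
  have [[r [r0 Br]]|] := pselect (exists r, 0 < r /\ B r x); last by exists None.
  have [n nr] := harmonic_below r0.
  exists (Some n) => z u v xz zn Gu Gv.
  have := Br _ _ _ xz (lt_le_trans zn _) Gu Gv; rewrite lerD2l => /(_ nr).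
  have n0 : 0 < n.+1%:R^-1 :> R by rewrite invr_gt0 ltr0n.
  have [vu _|uv] := leP (v - u) 0; last by apply: le_trans; rewrite ler_pM2r.
  apply: (@le_trans _ _ 0); last by rewrite subr_ge0 ltW.
  by rewrite mulr_ge0_le0 // ltW.
- exists a', (Num.min b' (a' + n.+1%:R^-1)), n.+1%:R; split=> //.
  + by rewrite lt_min a'b' ltrDl invr_gt0 ltr0n.
  + by rewrite ge_min b'b.
  move=> t t' y y' a't tt'; rewrite lt_min => /andP[t'b' t'n] Gy Gy'.
  rewrite ger0_norm; last first.
    by rewrite subr_ge0 (mono t t') // ?(le_lt_trans aa') ?(lt_le_trans t'b').
  rewrite -ler_pdivrMl ?ltr0n // (X' t) //.
    by rewrite a't (lt_trans tt').
  by rewrite (lt_trans t'n) // ltrD2r.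
(* If the points without a bound fill an interval, a function [h] with graph in [G] has unbounded
   slopes there. *)
exfalso; have hG t : exists y, a < t < b -> G t y.
  have [/totG[y Gy]|] := boolP (a < t < b); first by exists y.
  by exists 0.
have {hG} [h hG] := choice hG.
have inab t : a' < t -> t < b' -> a < t < b.
  by move=> a't tb'; rewrite (le_lt_trans aa') ?(lt_le_trans tb').
apply: (@unbounded_slopes_absurd h a' b' a'b').
  move=> t t' a't tt' t'b'; have /andP[a_t tb] := inab _ a't (lt_trans tt' t'b').
  have /andP[at' t'b] := inab _ (lt_trans a't tt') t'b'.
  by apply: (mono t t') => //; apply: hG; apply/andP.
move=> x r /andP[a'x xb'] r0.
have := X' x; rewrite a'x xb' => /(_ isT) nB.
have r'0 : 0 < Num.min r (b' - x) by rewrite lt_min r0 subr_gt0.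
apply: contrapT => nex; apply: nB; exists (Num.min r (b' - x)); split=> //.
move=> z u v xz; rewrite -ltrBlDl lt_min !ltrBlDl subrKC => /andP[zr zb'] Gu Gv.
have uE : u = h x by apply: fG Gu _; exact/hG/inab.
have vE : v = h z by apply: fG Gv _; apply/hG/inab => //; exact: lt_trans xz.
rewrite leNgt; apply/negP => zx; apply: nex; exists z; first by rewrite xz.
rewrite -uE -vE (lt_le_trans zx) // ler_wpM2r ?ge_min ?lexx //.
have /andP[ax xb] := inab _ a'x xb'.
by rewrite subr_ge0 (mono x z) // (lt_le_trans zb').
Qed.

Lemma definable_lipschitz G a b : a < b -> dfn2 G -> functional G ->
  total_on a b G ->
  exists a' b' L, [/\ a <= a', a' < b', b' <= b & lipschitz_graph L a' b' G].
Proof.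
move=> ab dG fG totG.
have [a1 [b1 [aa1 a1b1 b1b mono]]] := definable_monotone ab dG fG totG.
have tot1 t : a1 < t < b1 -> exists y, G t y.
  move=> /andP[a1t tb1]; apply: totG.
  by rewrite (le_lt_trans aa1) ?(lt_le_trans tb1).
case: mono => mono.
  have [a2 [b2 [L [? ? ? ?]]]] := definable_lipschitz_nondecreasing a1b1 dG fG tot1 mono.
  by exists a2, b2, L; split=> //; [exact: le_trans aa1 _|exact: le_trans b1b].
have dG' : dfn2 (fun t y => G t (- y)).
  apply: (@eq_dfn _ _ (fun e => exists y, G (e 0%N) y /\ y + e 1%N = 0)).
    move=> e; split=> [[y [Gy /eqP]]|Gy]; first by rewrite addr_eq0 => /eqP <-.
    by exists (- e 1%N); rewrite addNr.
  by dfn_auto dG.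
have fG' : functional (fun t y => G t (- y)).
  by move=> t y y' Gy Gy'; apply: oppr_inj; exact: fG Gy Gy'.
have tot' : total_on a1 b1 (fun t y => G t (- y)).
  by move=> t /tot1[y Gy]; exists (- y); rewrite opprK.
have [a2 [b2 [L [? ? ? lipG]]]] := definable_lipschitz_nondecreasing a1b1 dG' fG' tot' mono.
exists a2, b2, L; split=> //; [exact: le_trans aa1 _|exact: le_trans b1b|].
move=> t t' y y' a2t tt' t'b2 Gy Gy'.
have := lipG t t' (- y) (- y') a2t tt' t'b2; rewrite !opprK => /(_ Gy Gy').
by rewrite addrC distrC.
Qed.

Definition scons (y : R) (e : nat -> R) : nat -> R :=
  fun i => if i is j.+1 then e j else y.

(** Induction on the number [p] of controlled coordinates: the first is chosen definably and made
    Lipschitz, then treated as a function of [t] in the condition on the others. Coordinates from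
    [p] on are arbitrary. *)
Lemma lipschitz_selection (p : nat) (Z : (nat -> R) -> Prop) a b : a < b ->
  dfn S Z -> (forall t, a < t < b -> exists x, Z (scons t x)) ->
  exists a' b' L (X : R -> nat -> R), [/\ a <= a', a' < b', b' <= b,
    (forall t, a' < t < b' -> Z (scons t (X t))) &
    forall i t t', (i < p)%N -> a' < t -> t < t' -> t' < b' ->
      `|X t' i - X t i| <= L * (t' - t)].
Proof.
elim: p Z a b => [|p IHp] Z a b ab dZ totZ.
  have XP t : exists x, a < t < b -> Z (scons t x).
    have [/totZ[x Zx]|] := boolP (a < t < b); first by exists x.
    by exists (fun=> 0).
  by have [X ZX] := choice XP; exists a, b, 0, X; split.
pose A t y := exists x, Z (scons t (scons y x)).
have dA : dfn2 A.
  apply: eq_dfn (dfn_exs omS 2 dZ) => e; split=> [[x Zx]|[x Zx]].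
    exists (fun i => x i.+2); set e1 := (X in Z X) in Zx *.
    by rewrite (_ : scons _ _ = e1) //; apply/funext => -[|[|i]].
  exists (fun i => x i.-2); set e1 := (X in Z X) in Zx *.
  by rewrite (_ : (fun i => _) = e1) //; apply/funext => -[|[|i]].
have totA : total_on a b A.
  move=> t /totZ[x Zx]; exists (x 0%N), (x \o succn).
  set e1 := (X in Z X) in Zx *.
  by rewrite (_ : scons _ _ = e1) //; apply/funext => -[|[|i]].
have [a1 [b1 [G [aa1 a1b1 b1b [dG fG totG GA]]]]] := definable_choice ab dA totA.
have [a2 [b2 [L1 [a12 a2b2 b21 lipG]]]] := definable_lipschitz a1b1 dG fG totG.
pose Z1 e := exists y, G (e 0%N) y /\ Z (scons (e 0%N) (scons y (e \o succn))).
have dZ1 : dfn S Z1.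
  apply: dfn_ex => //; apply: (dfn_and omS); first by dfn_auto dG.
  (* Positions 0 and 1 are swapped: the quantifier puts [y] before [t], while [Z] reads [t]
     first. *)
  pose s i := if i is j.+2 then j.+2 else (1 - i)%N.
  apply: eq_dfn (dfn_subst omS s dZ) => e.
  set e1 := (X in Z X); set e2 := (X in _ <-> Z X).
  by rewrite (_ : e1 = e2) //; apply/funext => -[|[|i]].
have totZ1 t : a2 < t < b2 -> exists x, Z1 (scons t x).
  move=> /andP[a2t tb2]; have [|y Gy] := totG t.
    by rewrite (le_lt_trans a12) ?(lt_le_trans tb2).
  by have [x Zx] := GA _ _ Gy; exists x, y.
have [a3 [b3 [L2 [X1 [a23 a3b3 b32 ZX lipX]]]]] := IHp Z1 a2 b2 a2b2 dZ1 totZ1.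
have YP t : exists y, a3 < t < b3 -> G t y /\ Z (scons t (scons y (X1 t))).
  have [/ZX[y [Gy Zy]]|] := boolP (a3 < t < b3); first by exists y.
  by exists 0.
have [Y YE] := choice YP.
exists a3, b3, (Num.max L1 L2), (fun t => scons (Y t) (X1 t)); split=> //.
- by rewrite (le_trans aa1) // (le_trans a12).
- by rewrite (le_trans b32) // (le_trans b21).
- by move=> t /YE[].
move=> [|i] t t' lti a3t tt' t'b3 /=.
  have [Gt _] : G t (Y t) /\ Z (scons t (scons (Y t) (X1 t))).
    by apply: YE; rewrite a3t (lt_trans tt').
  have [Gt' _] : G t' (Y t') /\ Z (scons t' (scons (Y t') (X1 t'))).
    by apply: YE; rewrite t'b3 (lt_trans a3t).
  apply: le_trans (lipG t t' _ _ _ _ _ Gt Gt') _ => //.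
  - exact: le_lt_trans a3t.
  - exact: lt_le_trans b32.
  - by rewrite ler_wpM2r ?le_max ?lexx // subr_ge0 ltW.
apply: le_trans (lipX i t t' lti _ _ _) _ => //.
by rewrite ler_wpM2r ?le_max ?lexx ?orbT // subr_ge0 ltW.
Qed.

End definable_curves.

(** * Conservative fields along critical curves *)

(* Monotonicity for arbitrary functions: the integral is the difference of two
   suprema over simple functions, so no measurability is involved. *)
Lemma le_integral_pointwise (d : measure_display) (T : measurableType d)
    (R : realType) (mu : {measure set T -> \bar R}) (A : set T)
    (f g : T -> \bar R) :
  (forall x, A x -> (f x <= g x)%E) ->
  (\int[mu]_(x in A) f x <= \int[mu]_(x in A) g x)%E.
Proof.
move=> fg; have fgA x : ((f \_ A) x <= (g \_ A) x)%E.
  by rewrite /patch; case: ifPn => // /set_mem/fg.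
rewrite /integral; apply: leeB; apply: le_ereal_sup => _ [h hf <-];
  exists h => // x; apply: le_trans (hf x) _.
- by rewrite !funeposE ge_max !le_max fgA lexx orbT.
- by rewrite !funenegE ge_max !le_max leeN2 fgA lexx orbT.
Qed.

Section curves.
Variables (R : realType) (p : nat).
Implicit Types (g h : R -> 'rV[R]_p) (D : 'rV[R]_p -> set 'rV[R]_p).

Definition lipschitz_curve (L : R) g := forall s t, `|g t - g s| <= L * `|t - s|.

Lemma row_norm_le (v : 'rV[R]_p) (e : R) : 0 <= e ->
  (forall i, `|v ord0 i| <= e) -> `|v| <= e.
Proof.
move=> e0 ve; rewrite [leLHS]/Num.norm /= mx_normrE; apply: bigmax_le => // -[i j] _.
by rewrite ord1.
Qed.

Lemma lipschitz_abs_continuous L g : lipschitz_curve L g -> abs_continuous01 g.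
Proof.
move=> lipg e e0; have L0 : 0 < `|L| + 1 by rewrite ltr_wpDl.
exists (e / (`|L| + 1)); first by rewrite divr_gt0.
move=> k a b ab _; rewrite ltr_pdivlMr // mulrC => /(le_lt_trans _); apply.
rewrite mulr_sumr; apply: ler_sum => i _; have [_ [aib _]] := ab i.
rewrite (le_trans (lipg _ _)) // (ger0_norm (x := b i - a i)) ?subr_ge0 //.
by rewrite ler_wpM2r ?subr_ge0 // (le_trans (ler_norm _)) // lerDl.
Qed.

Lemma lipschitz_curveD L M g h : lipschitz_curve L g -> lipschitz_curve M h ->
  lipschitz_curve (L + M) (fun t => g t + h t).
Proof.
move=> lg lh s t; rewrite opprD addrACA (le_trans (ler_normD _ _)) // mulrDl.
exact: lerD.
Qed.

(** Composing with it extends a curve from [[0, 1]] to the line, resting before and after, without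
    increasing its Lipschitz constant. *)
Definition clamp01 (t : R) : R := Num.max 0 (Num.min 1 t).

Lemma clamp01_itv t : 0 <= clamp01 t <= 1.
Proof. by rewrite /clamp01 le_max lexx /= ge_max ler01 ge_min lexx. Qed.

Lemma clamp01_le0 t : t <= 0 -> clamp01 t = 0.
Proof. by move=> t0; rewrite /clamp01; case: (leP 1 t); case: (leP 0) => //; lra. Qed.

Lemma clamp01_ge1 t : 1 <= t -> clamp01 t = 1.
Proof. by move=> t1; rewrite /clamp01 (min_idPl t1) (max_idPr _). Qed.

Lemma clamp01_lipschitz s t : `|clamp01 t - clamp01 s| <= `|t - s|.
Proof.
wlog st : s t / s <= t => [th|].
  by have [/th//|/ltW/th] := leP s t; rewrite distrC [leRHS]distrC.
rewrite (@ger0_norm _ (t - s)) ?subr_ge0 // ler_norml /clamp01.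
case: (leP 1 t); case: (leP 1 s); rewrite ?(max_idPr ler01) => ? ?;
  try case: (leP 0 s) => ?; try case: (leP 0 t) => ?; lra.
Qed.

Lemma lipschitz_clamp01 L g (a b : R) : 0 <= L -> 0 <= a ->
  (forall s t, 0 <= s <= 1 -> 0 <= t <= 1 -> `|g t - g s| <= L * `|t - s|) ->
  lipschitz_curve (L * a) (fun t => g (clamp01 (a * t + b))).
Proof.
move=> L0 a0 lipg s t; rewrite (le_trans (lipg _ _ _ _)) ?clamp01_itv //.
rewrite -mulrA ler_wpM2l // (le_trans (clamp01_lipschitz _ _)) //.
by rewrite opprD addrACA subrr addr0 -mulrBr normrM (ger0_norm a0).
Qed.

Lemma derive1_near g h t : (\near t, g t = h t) -> derive1 g t = derive1 h t.
Proof. by move=> gh; rewrite !derive1E; exact: near_eq_derive. Qed.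

Lemma support_integrand_ge0 D g t : D (g t) 0 -> (0 <= support_integrand D g t)%E.
Proof.
move=> D0; apply: ereal_sup_ubound; exists 0 => //.
by congr EFin; rewrite /dotp big1 // => i _; rewrite mxE mulr0.
Qed.

Lemma support_integrand_cst D g t x : (\near t, g t = x) ->
  (support_integrand D g t <= 0)%E.
Proof.
move=> gx; have -> : support_integrand D g t =
    ereal_sup [set (dotp (derive1 (cst x : R -> 'rV[R]_p) t) v)%:E | v in D (g t)].
  by rewrite /support_integrand (derive1_near gx).
apply: ge_ereal_sup => _ [v _ <-]; rewrite derive1_cst lee_fin /dotp.
by rewrite big1 // => i _; rewrite mxE mul0r.
Qed.

(* Both curves run from 0 to [g 0]; then one rests while the other follows [g].
   The integrands compare pointwise because 0 is in [D] along [g]. *)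
Lemma conservative_critical_le D f L g : conservative_field_for D f -> 0 <= L ->
  (forall s t, 0 <= s <= 1 -> 0 <= t <= 1 -> `|g t - g s| <= L * `|t - s|) ->
  (forall t, 0 <= t <= 1 -> D (g t) 0) -> f (g 0) <= f (g 1).
Proof.
move=> [_ Df] L0 lipg crit.
(* [d1] reaches [g 0] at time 1/3 and rests; [d2] agrees with it until 2/3, then follows [g] up to
   time 1. *)
pose d1 t := clamp01 (3 * t + 0) *: g 0.
pose d2 t := d1 t + (g (clamp01 (3 * t + -2)) - g 0).
have lip1 : lipschitz_curve (`|g 0| * 3) d1.
  apply: (@lipschitz_clamp01 `|g 0| (fun t => t *: g 0)) => // s t _ _.
  by rewrite -scalerBl normrZ mulrC.
have lip2 : lipschitz_curve (`|g 0| * 3 + L * 3) d2.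
  apply: lipschitz_curveD => //.
  apply: (@lipschitz_clamp01 L (fun t => g t - g 0)) => // s t s01 t01.
  by rewrite opprB addrA subrK; exact: lipg.
have d10 : d1 0 = 0 by rewrite /d1 clamp01_le0 ?scale0r //; lra.
have d1x t : 1 / 3 <= t -> d1 t = g 0.
  by move=> t3; rewrite /d1 clamp01_ge1 ?scale1r //; lra.
have d20 : d2 0 = 0 by rewrite /d2 d10 clamp01_le0 ?subrr ?addr0 //; lra.
have d21 : d2 1 = g 1 by rewrite /d2 d1x ?clamp01_ge1 ?subrKC //; lra.
have := Df _ _ (lipschitz_abs_continuous lip1) d10 (d1x 1 _).
have -> : 1 / 3 <= 1 :> R by lra.
move=> /(_ isT) int1.
have int2 := Df _ _ (lipschitz_abs_continuous lip2) d20 d21.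
have le_shift (I1 I2 : \bar R) (x y z : R) : x%:E = (z%:E + I1)%E ->
    y%:E = (z%:E + I2)%E -> (I1 <= I2)%E -> x <= y.
  by move=> xE yE I12; rewrite -lee_fin xE yE leeD2l.
apply: le_shift int1 int2 _; apply: le_integral_pointwise => t _.
(* Before 2/3 the curves agree near [t]; from 2/3 on the integrand is at most 0 for [d1] and at
   least 0 for [d2]. *)
have [t23|t23] := ltP t (2 / 3).
  have eq12 : \near t, d1 t = d2 t.
    near=> s; rewrite /d2 clamp01_le0 ?subrr ?addr0 //.
    suff : s < 2 / 3 by lra.
    by near: s; exact: lt_nbhsl.
  by rewrite /support_integrand (derive1_near eq12) (nbhs_singleton eq12).
apply: (@le_trans _ _ 0%E).
  apply: (@support_integrand_cst _ _ _ (g 0)); near=> s; apply: d1x.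
  by apply: ltW; near: s; apply: lt_nbhsr; lra.
apply: support_integrand_ge0; rewrite /d2 d1x ?subrKC; last lra.
by apply: crit; exact: clamp01_itv.
Unshelve. all: by end_near. Qed.

Lemma conservative_critical_cst D f L g : conservative_field_for D f -> 0 <= L ->
  (forall s t, 0 <= s <= 1 -> 0 <= t <= 1 -> `|g t - g s| <= L * `|t - s|) ->
  (forall t, 0 <= t <= 1 -> D (g t) 0) -> f (g 0) = f (g 1).
Proof.
move=> Df L0 lipg crit; apply/le_anti/andP; split.
  exact: conservative_critical_le Df L0 lipg crit.
pose h t := g (1 - t).
have h01 (t : R) : 0 <= t <= 1 -> 0 <= 1 - t <= 1 by lra.
have := @conservative_critical_le D f L h Df L0; rewrite /h subr0 subrr; apply.
- move=> s t /h01 s01 /h01 t01; rewrite (le_trans (lipg _ _ _ _)) //.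
  by rewrite (_ : 1 - t - (1 - s) = s - t) 1?distrC //; lra.
- by move=> t /h01; exact: crit.
Qed.

End curves.

(** * Finiteness of the set of critical values *)

Theorem theorem5 (R : realType) (S : forall n : nat, set (set 'rV[R]_n))
    (p : nat) (D : 'rV[R]_p -> set 'rV[R]_p) (f : 'rV[R]_p -> R) :
  o_minimal S ->
  conservative_field_for D f ->
  definable_fun S f ->
  definable_setmap S D ->
  finite_set [set f x | x in [set x | D x 0]].
Proof.
move=> omS Df deff defD.
pose pt (e : nat -> R) : 'rV[R]_p := \row_(i < p) e i.
(* Position 0 holds the critical value, positions 1 to [p] the critical point. *)
pose Z e := f (pt (e \o succn)) = e 0%N /\ D (pt (e \o succn)) 0.
have dZ : dfn S Z.
  apply: dfn_and => //.
    have df := dfn_set deff.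
    pose s i := if (i < p)%N then i.+1 else 0%N.
    apply: eq_dfn (dfn_subst omS s df) => e /=.
    rewrite (_ : lsubmx _ = pt (e \o succn)); last first.
      by apply/rowP => i; rewrite !mxE /s /= ltn_ord.
    by rewrite !mxE /s /= addn0 ltnn.
  have dD := dfn_set defD.
  (* Substitution only renames variables, so the zero vector is written as one variable equal to 0,
     repeated [p] times. *)
  apply: (@eq_dfn _ _ (fun e => exists y, y = 0 /\
      D (pt (e \o succn)) (\row_(i < p) y))).
    have r0 : \row_(i < p) 0 = 0 :> 'rV[R]_p by apply/rowP => i; rewrite !mxE.
    move=> e; split=> [[y [-> ]]|De]; first by rewrite r0.
    by exists 0; rewrite r0.
  apply: dfn_ex => //; apply: dfn_and => //; first exact: dfn_eq_cst.
  pose s i := if (i < p)%N then i.+2 else 0%N.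
  apply: eq_dfn (dfn_subst omS s dD) => e /=.
  rewrite (_ : lsubmx _ = pt ((fun i => e i.+1) \o succn)); last first.
    by apply/rowP => i; rewrite !mxE /s /= ltn_ord.
  rewrite (_ : rsubmx _ = \row_(i < p) e 0%N) //.
  by apply/rowP => i; rewrite !mxE /s /= ltnNge leq_addr.
have dV : dfn S (fun e => exists x, Z (scons (e 0%N) x)).
  apply: eq_dfn (dfn_exs omS 1 dZ) => e; split=> [[x Zx]|[x Zx]].
    exists (x \o succn); set e1 := (X in Z X) in Zx *.
    by rewrite (_ : scons _ _ = e1) //; apply/funext => -[|i].
  exists (fun i => x i.-1); set e1 := (X in Z X) in Zx *.
  by rewrite (_ : (fun i => _) = e1) //; apply/funext => -[|i].
have uV := dfn_section omS (P := fun t => exists x, Z (scons t x)) dV.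
have [|[a [b [ab _ _ abV]]]] := unions_of_intervals_interior `]-oo, +oo[ uV.
  rewrite set_itvE setIT; apply: sub_finite_set => _ [x Dx0 <-].
  exists (rvenv x); have ptx : pt (scons (f x) (rvenv x) \o succn) = x.
    exact: row_rvenv.
  by rewrite /Z ptx.
have [a' [b' [L [X [aa' a'b' b'b ZX lipX]]]]] :=
  lipschitz_selection omS p ab dZ abV.
exfalso.
(* The selection is controlled on the open interval only; [tau] maps [[0, 1]] affinely onto the
   closed middle third. *)
pose c := a' + (b' - a') / 3; pose d := a' + (b' - a') * 2 / 3.
have cd : c < d by rewrite /c /d; lra.
pose tau u := c + u * (d - c).
have tau_itv u : 0 <= u <= 1 -> a' < tau u < b'.
  by move=> u01; rewrite /tau /c /d; nra.
pose g u := pt (X (tau u)).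
have gZ u : 0 <= u <= 1 -> f (g u) = tau u /\ D (g u) 0.
  by move=> /tau_itv /ZX.
have lipg s t : 0 <= s <= 1 -> 0 <= t <= 1 ->
    `|g t - g s| <= `|L| * (d - c) * `|t - s|.
  wlog : s t / s < t => [th s01 t01|st s01 t01].
    have [st|ts|->] := ltgtP s t; first exact: th.
      by rewrite distrC [`|t - s|]distrC; exact: th.
    by rewrite !subrr !normr0 mulr0.
  have ts0 : 0 <= t - s by rewrite subr_ge0 ltW.
  have dc0 : 0 <= d - c by rewrite subr_ge0 ltW.
  apply: row_norm_le => [|i]; first by rewrite !mulr_ge0.
  rewrite !mxE (ger0_norm ts0).
  have /andP[ts1 _] := tau_itv _ s01; have /andP[_ tt1] := tau_itv _ t01.
  have st' : tau s < tau t by rewrite /tau ltrD2l ltr_pM2r // subr_gt0.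
  apply: le_trans (lipX i _ _ (ltn_ord i) ts1 st' tt1) _.
  have -> : tau t - tau s = (d - c) * (t - s) by rewrite /tau; lra.
  by rewrite mulrA !ler_wpM2r // ler_norm.
have Lcd : 0 <= `|L| * (d - c) by rewrite mulr_ge0 // subr_ge0 ltW.
(* [f] is constant along [g], yet [f (g u) = tau u]; hence [c = d], a contradiction. *)
have := conservative_critical_cst Df Lcd lipg (fun u hu => (gZ u hu).2).
have [-> _] : f (g 0) = tau 0 /\ D (g 0) 0 by apply: gZ; rewrite lexx ler01.
have [-> _] : f (g 1) = tau 1 /\ D (g 1) 0 by apply: gZ; rewrite lexx ler01.
by rewrite /tau; lra.
Qed.
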